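(* Let $F:\mathbb{R}^d\to\mathbb{R}$ satisfy $F\in\mathbb{C}_L^1$ and $F^*=\inf_x F(x)>-\infty$. Let $x_0\in\mathbb{R}^d$, $b_0>0$, $\eta>0$, and consider AdaGrad-Norm in the deterministic setting: for $j=1,2,\ldots$, $$x_j=x_{j-1}-\frac{\eta}{b_j}\nabla F(x_{j-1})\quad\text{with}\quad b_j^2=b_{j-1}^2+\|\nabla F(x_{j-1})\|^2,\quad b_j>0.$$ Let $\varepsilon>0$. Then $\min_{j\in\{0,1,\ldots,N\}}\|\nabla F(x_j)\|^2\le\varepsilon$ for (1) $\displaystyle N=1+\left\lceil\frac1\varepsilon\left(\frac{4(F(x_0)-F^* )^2}{\eta^2}+\frac{2b_0(F(x_0)-F^* )}{\eta}\right)\right\rceil$ if $b_0\ge\eta L$; (2) $\displaystyle N=1+\left\lceil\frac1\varepsilon\left(2L(F(x_0)-F^* )+\left(\frac{2(F(x_0)-F^* )}{\eta}+\eta L\,C_{b_0}\right)^2+(\eta L)^2(1+C_{b_0})-b_0^2\right)\right\rceil$ if $b_0<\eta L$, where $C_{b_0}=1+2\log\left(\frac{\eta L}{b_0}\right)$.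
   Context: $\|\cdot\|$ is the $\ell_2$ norm. $F\in\mathbb{C}_L^1$ means that $F$ is differentiable with $L$-Lipschitz gradient, i.e. $\|\nabla F(x)-\nabla F(y)\|\le L\|x-y\|$ for all $x,y\in\mathbb{R}^d$, where $L>0$ is the smallest such number. *)

(* Defs.v *)
From HB Require Import structures.
From mathcomp Require Import all_boot all_order all_algebra.
From mathcomp Require Import all_classical all_reals all_analysis.
Set Implicit Arguments.
Unset Strict Implicit.
Unset Printing Implicit Defensive.
Import Order.TTheory GRing.Theory Num.Theory.
Import numFieldNormedType.Exports.
Local Open Scope classical_set_scope.
Local Open Scope ring_scope.

(* The library norm [`|x|] on ['rV[R]_d] is the sup norm, hence an explicit
   Euclidean norm. [differentiable] (Frechet) does not depend on which of the
   two equivalent norms is used. *)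
Definition l2norm (R : realType) (d : nat) (x : 'rV[R]_d) : R :=
  Num.sqrt (\sum_(i < d) x 0 i ^+ 2).

Definition gradient (R : realType) (d : nat) (F : 'rV[R]_d -> R)
    (x : 'rV[R]_d) : 'rV[R]_d :=
  \row_(i < d) 'D_(delta_mx 0 i) F x.

Definition gradient_lipschitz (R : realType) (d : nat) (L : R)
    (F : 'rV[R]_d -> R) : Prop :=
  forall x y : 'rV[R]_d,
    l2norm (gradient F x - gradient F y) <= L * l2norm (x - y).

Definition C1L (R : realType) (d : nat) (L : R) (F : 'rV[R]_d -> R) : Prop :=
  [/\ forall x : 'rV[R]_d, differentiable F x,
      0 < L,
      gradient_lipschitz L F &
      forall K : R, 0 < K -> gradient_lipschitz K F -> L <= K].

Definition adagrad_norm (R : realType) (d : nat) (F : 'rV[R]_d -> R)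
    (eta : R) (x0 : 'rV[R]_d) (b0 : R)
    (x : nat -> 'rV[R]_d) (b : nat -> R) : Prop :=
  [/\ x 0%N = x0, b 0%N = b0 &
      forall j : nat,
        [/\ x j.+1 = x j - (eta / b j.+1) *: gradient F (x j),
            b j.+1 ^+ 2 = b j ^+ 2 + l2norm (gradient F (x j)) ^+ 2 &
            0 < b j.+1]].

(* The minimum over j in {0, ..., N}; seeding the iterated minimum with the
   j = 0 term does not change its value. *)
Definition min_sq_gradient (R : realType) (d : nat) (F : 'rV[R]_d -> R)
    (x : nat -> 'rV[R]_d) (N : nat) : R :=
  \big[Num.min/l2norm (gradient F (x 0%N)) ^+ 2]_(j < N.+1)
    l2norm (gradient F (x j)) ^+ 2.

(* Main.v *)
(** Write g_j = |grad F(x_j)|^2. The descent lemma gives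
    F(x_{j+1}) <= F(x_j) - (eta / b_{j+1}) (1 - eta L / (2 b_{j+1})) g_j, so once
    b_{j+1} >= eta L each step decreases F by at least eta g_j / (2 b_{j+1}).
    Summing from an index m, and using b_{j+1} <= b_n and
    b_n^2 - b_m^2 = sum of the g_j, gives (b_n^2 - b_m^2) / b_n <= A with
    A = 2 (F(x_m) - F^* ) / eta, whence b_n <= A + b_m and
    b_n^2 - b_m^2 <= A (A + b_m). If b_0 < eta L, take for m the last index before
    b exceeds eta L; up to m, F increases by at most
    (eta^2 L / 2) sum g_j / b_{j+1}^2 <= eta^2 L log (b_m / b_0). In both cases the
    sum of all g_j is bounded by a constant X, so g_j > eps for all j <= N forces
    N eps <= X. *)

Require Import Defs.
From HB Require Import structures.
From mathcomp Require Import all_boot all_order all_algebra ring lra.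
From mathcomp Require Import all_classical all_reals all_analysis.
Import Order.TTheory GRing.Theory Num.Theory.
Import numFieldNormedType.Exports.
Local Open Scope classical_set_scope.
Local Open Scope ring_scope.

(** * Euclidean norm and inner product *)

Lemma sqr_l2norm (R : realType) (d : nat) (u : 'rV[R]_d) :
  l2norm u ^+ 2 = \sum_(i < d) u 0 i ^+ 2.
Proof. by rewrite sqr_sqrtr// sumr_ge0// => i _; exact: sqr_ge0. Qed.

Lemma l2normZ (R : realType) (d : nat) (a : R) (u : 'rV[R]_d) :
  l2norm (a *: u) = `|a| * l2norm u.
Proof.
rewrite /l2norm; under eq_bigr do rewrite mxE exprMn.
by rewrite -mulr_sumr sqrtrM ?sqr_ge0// sqrtr_sqr.
Qed.

(** Expanding |u - c v|^2 >= 0 bounds 2c <u, v> by |u|^2 + c^2 |v|^2, hence by 2 c^2 |v|^2; this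
    stands in for Cauchy-Schwarz. *)
Lemma sum_mul_le_sqr_l2norm (R : realType) (d : nat) (c : R)
    (u v : 'rV[R]_d) :
  0 < c -> l2norm u <= c * l2norm v ->
  \sum_(i < d) u 0 i * v 0 i <= c * l2norm v ^+ 2.
Proof.
move=> c0 uv.
have u2 : l2norm u ^+ 2 <= c ^+ 2 * l2norm v ^+ 2.
  by rewrite -exprMn lerXn2r// nnegrE ?mulr_ge0 ?sqrtr_ge0// ltW.
have amgm : 2 * c * (\sum_(i < d) u 0 i * v 0 i)
    <= l2norm u ^+ 2 + c ^+ 2 * l2norm v ^+ 2.
  rewrite !sqr_l2norm !mulr_sumr -big_split ler_sum// => i _ /=.
  rewrite -subr_ge0.
  have -> : u 0 i ^+ 2 + c ^+ 2 * v 0 i ^+ 2 - 2 * c * (u 0 i * v 0 i)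
    = (u 0 i - c * v 0 i) ^+ 2 by ring.
  exact: sqr_ge0.
rewrite -(ler_pM2l (_ : 0 < 2 * c)) ?mulr_gt0//; apply: le_trans amgm _.
by move: u2; lra.
Qed.

(** * Directional derivatives and the descent lemma *)

Lemma derive_gradient (R : realType) (d : nat) (F : 'rV[R]_d -> R)
    (x v : 'rV[R]_d) :
  differentiable F x -> 'D_v F x = \sum_(i < d) gradient F x 0 i * v 0 i.
Proof.
move=> dF; rewrite deriveE// [v in LHS]row_sum_delta linear_sum.
by apply: eq_bigr => i _; rewrite linearZ /= mxE deriveE// mulrC.
Qed.

Lemma is_derive_line (R : realType) (d : nat) (F : 'rV[R]_d -> R)
    (x v : 'rV[R]_d) (t : R) :
  differentiable F (x + t *: v) ->
  is_derive t 1 (fun s : R => F (x + s *: v)) ('D_v F (x + t *: v)).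
Proof.
move=> dF.
have E : (fun h : R => h^-1 *: (((fun s : R => F (x + s *: v)) \o shift t) (h *: 1)
            - F (x + t *: v)))
       = (fun h : R => h^-1 *: ((F \o shift (x + t *: v)) (h *: v)
            - F (x + t *: v))).
  apply/funext => h /=; congr (_ *: (F _ - _)).
  by rewrite [h *: 1]mulr1 scalerDl addrCA.
apply: DeriveDef; last by rewrite /derive E.
by rewrite /derivable E; exact: diff_derivable.
Qed.

Lemma descent_lemma (R : realType) (d : nat) (F : 'rV[R]_d -> R) (L : R)
    (x v : 'rV[R]_d) :
  (forall y, differentiable F y) -> 0 < L -> gradient_lipschitz L F ->
  F (x + v) <= F x + \sum_(i < d) gradient F x 0 i * v 0 i
               + L / 2 * l2norm v ^+ 2.
Proof.
move=> dF L0 LF.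
pose s := \sum_(i < d) gradient F x 0 i * v 0 i.
pose q := l2norm v ^+ 2.
(* phi is nonincreasing on [0, 1], and phi 1 <= phi 0 is the claim. *)
pose phi := (fun t : R => F (x + t *: v)) - (fun t => t * s + L / 2 * q * t ^+ 2).
pose dphi t := 'D_v F (x + t *: v) - (s + L * q * t).
have phi' (t : R) : is_derive t 1 phi (dphi t).
  apply: is_deriveB; first exact: is_derive_line.
  apply: is_derive_eq.
  by rewrite /GRing.scale/= !mulr0 !add0r !mulr1; field.
have dphi_le0 t : 0 < t -> dphi t <= 0.
  move=> t0; rewrite /dphi derive_gradient//.
  rewrite opprD addrA -sumrB subr_le0.
  have -> : \sum_(i < d) (gradient F (x + t *: v) 0 i * v 0 i
                          - gradient F x 0 i * v 0 i)
      = \sum_(i < d) (gradient F (x + t *: v) - gradient F x) 0 i * v 0 i.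
    by apply: eq_bigr => i _; rewrite !mxE mulrBl.
  (* Applied with c = L t: the gradients at x + t v and x differ by at most L t |v|. *)
  rewrite mulrAC -/q; apply: sum_mul_le_sqr_l2norm; first by rewrite mulr_gt0.
  rewrite (le_trans (LF _ _))// addrC addKr l2normZ gtr0_norm//.
  by rewrite mulrA.
have : phi 1 <= phi 0.
  apply: (@ler0_derive1_le_cc _ phi 0 1) => //.
  - move=> t; rewrite in_itv/= => /andP[t0 _].
    by rewrite derive1E derive_val dphi_le0.
  - apply: derivable_within_continuous => t _; exact: ex_derive.
  - by rewrite in_itv/= lexx ler01.
  - by rewrite in_itv/= lexx ler01.
rewrite /phi !fctE scale1r scale0r addr0 mul0r mul1r expr0n expr1n /= -/s -/q.
rewrite mulr0 mulr1; lra.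
Qed.

(** * Real sequences with b_{n+1}^2 = b_n^2 + g_n *)

Lemma le_of_sqr_incr (R : realType) (g b : nat -> R) :
  (forall n, 0 < b n) -> (forall n, 0 <= g n) ->
  (forall n, b n.+1 ^+ 2 = b n ^+ 2 + g n) ->
  {homo b : m n / (m <= n)%N >-> m <= n}.
Proof.
move=> b0 g0 bS; apply: homo_leq => [//|x y z|n]; first exact: le_trans.
by rewrite -ler_sqr ?nnegrE ?(ltW (b0 _))// bS lerDl.
Qed.

Lemma sqr_incr_bound (R : realType) (eta fstar A : R) (f g b : nat -> R)
    (n : nat) :
  0 < eta -> (forall n, 0 < b n) -> (forall n, 0 <= g n) ->
  (forall n, b n.+1 ^+ 2 = b n ^+ 2 + g n) ->
  (forall n, fstar <= f n) ->
  (forall n, eta * g n <= 2 * b n.+1 * (f n - f n.+1)) ->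
  A = 2 * (f 0%N - fstar) / eta ->
  b n ^+ 2 - b 0%N ^+ 2 <= A * (A + b 0%N).
Proof.
move=> eta0 b0 g0 bS fge dec defA.
have bmono := le_of_sqr_incr _ _ _ b0 g0 bS.
have fmono k : f k.+1 <= f k.
  rewrite -subr_ge0 -(pmulr_rge0 _ (_ : 0 < 2 * b k.+1)) ?mulr_gt0//.
  by rewrite (le_trans _ (dec k))// mulr_ge0// ltW.
have f0 k : f k <= f 0%N by elim: k => // k IH; exact: le_trans IH.
(* In the induction the factor b_k may be raised to b_{k+1} because f_0 - f_k >= 0. *)
have key : eta * (b n ^+ 2 - b 0%N ^+ 2) <= 2 * b n * (f 0%N - f n).
  elim: n => [|k IH]; first by rewrite !subrr !mulr0.
  have := ler_wpM2r (_ : 0 <= f 0%N - f k) (bmono _ _ (leqnSn k)).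
  rewrite subr_ge0 bS => /(_ (f0 k)); have := dec k; lra.
have A0 : 0 <= A by rewrite defA divr_ge0 ?mulr_ge0 ?subr_ge0// ltW.
have etaA : eta * A = 2 * (f 0%N - fstar) by rewrite defA; field; rewrite gt_eqF.
have leA : b n ^+ 2 - b 0%N ^+ 2 <= b n * A.
  rewrite -(ler_pM2l eta0) (le_trans key)// mulrCA etaA.
  have := ler_wpM2l (ltW (b0 n)) (fge n); lra.
(* Divide the previous bound by b_n, using b_0^2 <= b_n b_0. *)
have leb : b n <= b 0%N + A.
  rewrite -(ler_pM2l (b0 n)).
  have := ler_wpM2r (ltW (b0 0%N)) (bmono _ _ (leq0n n)); lra.
by apply: (le_trans leA); rewrite mulrC ler_wpM2l// addrC.
Qed.

(** The increments are dominated by a telescoping sum of logarithms; the factor 2 comes from ln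
    (b^2) = 2 ln b. *)
Lemma log_growth_bound (R : realType) (c : R) (f g b : nat -> R) (n : nat) :
  0 <= c -> (forall n, 0 < b n) ->
  (forall n, b n.+1 ^+ 2 = b n ^+ 2 + g n) ->
  (forall n, f n.+1 <= f n + c * (g n / b n.+1 ^+ 2)) ->
  f n <= f 0%N + 2 * c * ln (b n / b 0%N).
Proof.
move=> c0 b0 bS incr.
rewrite ln_div ?posrE//.
elim: n => [|n IH]; first by rewrite subrr mulr0 addr0.
(* g_n / b_{n+1}^2 = 1 - y <= - ln y with y = b_n^2 / b_{n+1}^2 *)
have gle : g n / b n.+1 ^+ 2 <= 2 * (ln (b n.+1) - ln (b n)).
  have b20 : 0 < b n.+1 ^+ 2 by rewrite exprn_gt0.
  have -> : g n / b n.+1 ^+ 2 = - (b n ^+ 2 / b n.+1 ^+ 2 - 1).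
    have -> : g n = b n.+1 ^+ 2 - b n ^+ 2 by rewrite bS; ring.
    by field; rewrite gt_eqF.
  have -> : 2 * (ln (b n.+1) - ln (b n)) = - ln (b n ^+ 2 / b n.+1 ^+ 2).
    by rewrite ln_div ?posrE ?exprn_gt0// !lnXn//; ring.
  rewrite lerN2 -[X in ln X](subrKC 1) le_ln1Dx//.
  by rewrite ltrBrDl subrr divr_gt0// exprn_gt0.
have := incr n; have := ler_wpM2l c0 gle; lra.
Qed.

(** When b >= eta L, the quadratic term costs at most half of the linear decrease eta g / b. *)
Lemma descent_half_step (R : realType) (eta L f f' g b : R) :
  0 < eta -> 0 < b -> 0 <= g -> eta * L <= b ->
  f' <= f - eta / b * g + L / 2 * ((eta / b) ^+ 2 * g) ->
  eta * g <= 2 * b * (f - f').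
Proof.
move=> eta0 b0 g0 Lb dec.
have cancel : eta / b * g * b = eta * g by field; rewrite gt_eqF.
have small : L * ((eta / b) ^+ 2 * g) * b <= eta * g.
  have -> : L * ((eta / b) ^+ 2 * g) * b = eta * L / b * (eta * g).
    by field; rewrite gt_eqF.
  by rewrite ler_piMl ?(mulr_ge0 (ltW eta0))// ler_pdivrMr ?mul1r.
have := ler_wpM2l (ltW b0) dec; lra.
Qed.

Lemma sqr_incr_bound_small (R : realType) (eta L fstar gap C : R)
    (f g b : nat -> R) (n : nat) :
  0 < eta -> 0 < L -> (forall n, 0 < b n) -> (forall n, 0 <= g n) ->
  (forall n, b n.+1 ^+ 2 = b n ^+ 2 + g n) ->
  (forall n, fstar <= f n) ->
  (forall n, f n.+1 <= f n - eta / b n.+1 * g n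
                       + L / 2 * ((eta / b n.+1) ^+ 2 * g n)) ->
  b 0%N < eta * L ->
  gap = f 0%N - fstar ->
  C = 1 + 2 * ln (eta * L / b 0%N) ->
  b n ^+ 2 - b 0%N ^+ 2 <=
    2 * L * gap + (2 * gap / eta + eta * L * C) ^+ 2
    + (eta * L) ^+ 2 * (1 + C) - b 0%N ^+ 2.
Proof.
move=> eta0 L0 b0 g0 bS fge dec bL defgap defC.
have bmono := le_of_sqr_incr _ _ _ b0 g0 bS.
have eL0 : 0 < eta * L by rewrite mulr_gt0.
have gap0 : 0 <= gap by rewrite defgap subr_ge0.
have ln0 : 0 <= ln (eta * L / b 0%N).
  by rewrite ln_ge0// ler_pdivlMr// mul1r ltW.
have C0 : 0 <= C by rewrite defC addr_ge0// mulr_ge0.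
rewrite lerD2r.
have Lgap0 : 0 <= 2 * L * gap by rewrite mulr_ge0// mulr_ge0// ltW.
set B := 2 * gap / eta + eta * L * C.
(* If the threshold is not passed by index n, the term (eta L)^2 alone suffices. *)
have [bn_le|bn_gt] := leP (b n) (eta * L).
  have : b n ^+ 2 <= (eta * L) ^+ 2 by rewrite lerXn2r// nnegrE ltW.
  have : 0 <= (eta * L) ^+ 2 * C by rewrite mulr_ge0// sqr_ge0.
  have := sqr_ge0 B; lra.
(* The first index past the threshold is not 0, so it is m + 1 with b_m <= eta L < b_{m+1}. *)
have [|[|m] bm_gt min_m] := @ex_minnP (fun k => eta * L < b k).
- by exists n.
- by rewrite ltNge ltW in bm_gt.
have bm_le : b m <= eta * L.
  by rewrite leNgt; apply/negP => /min_m; rewrite ltnn.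
have mn : (m <= n)%N by apply: ltnW; exact: min_m.
(* First phase: drop the linear decrease and keep the quadratic term, with c = L eta^2 / 2. *)
have fm : f m <= f 0%N + eta ^+ 2 * L * ln (eta * L / b 0%N).
  have := @log_growth_bound _ (L / 2 * eta ^+ 2) f g b m.
  have -> : 2 * (L / 2 * eta ^+ 2) = eta ^+ 2 * L by field.
  move=> /(_ _ b0 bS) fm; apply: le_trans (fm _ _) _.
  - by rewrite mulr_ge0 ?sqr_ge0// divr_ge0// ltW.
  - move=> k; apply: le_trans (dec k) _; rewrite lerD//.
      by rewrite gerBl mulr_ge0// divr_ge0// ltW.
    by rewrite expr_div_n -!mulrA [g k * _]mulrC.
  rewrite lerD2l ler_wpM2l ?(mulr_ge0 (sqr_ge0 _) (ltW L0))//.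
  by rewrite ler_ln ?posrE ?divr_gt0// ler_pM2r ?invr_gt0.
pose A := 2 * (f m - fstar) / eta.
have A0 : 0 <= A by rewrite divr_ge0 ?mulr_ge0 ?subr_ge0// ltW.
(* The summand 1 of C leaves a slack: in fact A <= B - eta L. *)
have AB : A <= B.
  rewrite /A ler_pdivrMr//.
  have -> : B * eta = 2 * gap + eta ^+ 2 * L * C.
    by rewrite /B; field; rewrite gt_eqF.
  rewrite defC defgap.
  have : 0 < eta ^+ 2 * L by rewrite mulr_gt0// exprn_gt0.
  lra.
(* Second phase: sequences restarted at m, whose steps use b_{m+j+1} >= b_{m+1} > eta L. *)
have := @sqr_incr_bound _ eta fstar A (fun j => f (m + j)%N)
  (fun j => g (m + j)%N) (fun j => b (m + j)%N) (n - m) eta0.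
rewrite subnKC// addn0 => bound.
have {bound} : b n ^+ 2 - b m ^+ 2 <= A * (A + b m).
  apply: bound => // j; rewrite ?addnS ?bS//.
  apply: descent_half_step (dec _) => //.
  by rewrite (le_trans (ltW bm_gt))// bmono// ltnS leq_addr.
have : A * (A + b m) <= B * (B + eta * L).
  by rewrite ler_pM ?addr_ge0 ?lerD// ltW.
have : b m ^+ 2 <= (eta * L) ^+ 2 by rewrite lerXn2r// nnegrE ltW.
(* The cross term of B (B + eta L) produces 2 L gap and (eta L)^2 C; the remaining (eta L)^2 pays
   for b_m^2. *)
have : B * (eta * L) = 2 * L * gap + (eta * L) ^+ 2 * C.
  by rewrite /B; field; rewrite gt_eqF.
lra.
Qed.

(** * From a bound on the sum of squared gradients to the least of them *)

Lemma min_sq_gradient_le (R : realType) (d : nat) (F : 'rV[R]_d -> R)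
    (x : nat -> 'rV[R]_d) (b : nat -> R) (eps X : R) :
  0 < eps ->
  (forall n, b n.+1 ^+ 2 = b n ^+ 2 + l2norm (gradient F (x n)) ^+ 2) ->
  (forall n, b n ^+ 2 - b 0%N ^+ 2 <= X) ->
  exists2 N : nat, N%:Z = 1 + Num.ceil (1 / eps * X)
    & min_sq_gradient F x N <= eps.
Proof.
move=> eps0 bS bX.
(* The bound at index 0 makes the ceiling nonnegative, so N is a natural number. *)
have X0 : 0 <= X by have := bX 0%N; rewrite subrr.
have Xeps0 : 0 <= 1 / eps * X by rewrite mulr_ge0// divr_ge0// ltW.
have ceil0 : 0 <= Num.ceil (1 / eps * X).
  by rewrite ceil_ge0 (lt_le_trans _ Xeps0)// ltrN10.
have [N defN] : exists N : nat, N%:Z = 1 + Num.ceil (1 / eps * X).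
  by exists (absz (1 + Num.ceil (1 / eps * X))); rewrite gez0_abs// addr_ge0.
exists N => //.
have NE : N%:R = 1 + (Num.ceil (1 / eps * X))%:~R :> R.
  by rewrite -[N%:R]/(N%:Z%:~R) defN intrD.
rewrite leNgt; apply/negP => lt_min.
have lt_g j : (j <= N)%N -> eps < l2norm (gradient F (x j)) ^+ 2.
  move=> jN; apply: (lt_le_trans lt_min).
  by rewrite (bigmin_le _ (Ordinal (jN : (j < N.+1)%N))).
have sum_g j : (j <= N)%N -> eps * j%:R <= b j ^+ 2 - b 0%N ^+ 2.
  elim: j => [|j IH] jN; first by rewrite mulr0 subrr.
  rewrite bS -[j.+1%:R]natr1; have := IH (ltnW jN).
  by have := lt_g j (ltnW jN); lra.
have := le_trans (sum_g N (leqnn _)) (bX N).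
(* The 1 added to the ceiling gives N eps >= X + eps > X. *)
apply/negP; rewrite -ltNge NE.
have : eps * (1 / eps * X) = X by field; rewrite gt_eqF.
have := ler_wpM2l (ltW eps0) (ceil_ge (1 / eps * X)); lra.
Qed.

Theorem theorem2p2 (R : realType) (d : nat) (F : 'rV[R]_d -> R) (L : R)
    (F_C1L : C1L L F) (F_lb : has_lbound (range F))
    (x0 : 'rV[R]_d) (b0 eta : R) (b0_gt0 : 0 < b0) (eta_gt0 : 0 < eta)
    (x : nat -> 'rV[R]_d) (b : nat -> R)
    (x_b : adagrad_norm F eta x0 b0 x b)
    (eps : R) (eps_gt0 : 0 < eps) :
  let Fstar := inf (range F) in
  let gap := F x0 - Fstar in
  let C := 1 + 2 * ln (eta * L / b0) in
  (eta * L <= b0 ->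
    exists2 N : nat,
      N%:Z = 1 + Num.ceil (1 / eps * (4 * gap ^+ 2 / eta ^+ 2
                                      + 2 * b0 * gap / eta))
      & min_sq_gradient F x N <= eps)
  /\
  (b0 < eta * L ->
    exists2 N : nat,
      N%:Z = 1 + Num.ceil (1 / eps * (2 * L * gap
                                      + (2 * gap / eta + eta * L * C) ^+ 2
                                      + (eta * L) ^+ 2 * (1 + C)
                                      - b0 ^+ 2))
      & min_sq_gradient F x N <= eps).
Proof.
move=> Fstar gap C.
have [dF L0 LF _] := F_C1L; have [x00 b00 xbS] := x_b.
pose g n := l2norm (gradient F (x n)) ^+ 2.
have b_gt0 n : 0 < b n by case: n => [|n]; [rewrite b00|have [] := xbS n].
have g_ge0 n : 0 <= g n by exact: sqr_ge0.
have bS n : b n.+1 ^+ 2 = b n ^+ 2 + g n by have [] := xbS n.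
have F_ge n : Fstar <= F (x n) by apply: (ge_inf F_lb); exists (x n).
(* Descent lemma with v = -(eta / b_{n+1}) grad F(x_n). *)
have dec n : F (x n.+1) <= F (x n) - eta / b n.+1 * g n
                       + L / 2 * ((eta / b n.+1) ^+ 2 * g n).
  have [-> _ _] := xbS n; rewrite -scaleNr.
  apply: (le_trans (descent_lemma _ _ _ _ _ _ dF L0 LF)).
  rewrite l2normZ normrN exprMn real_normK ?num_real// lerD2r lerD2l.
  rewrite /g sqr_l2norm mulr_sumr -sumrN ler_sum// => i _.
  by rewrite !mxE mulNr mulrN mulrCA expr2.
split=> [Lb|bL]; apply: (min_sq_gradient_le _ _ _ _ b) => // n.
(* The constant is A (A + b_0) with A = 2 gap / eta; every b_{k+1} >= b_0 >= eta L, so there is no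
   first phase. *)
- have -> : 4 * gap ^+ 2 / eta ^+ 2 + 2 * b0 * gap / eta
      = 2 * gap / eta * (2 * gap / eta + b 0%N).
    by rewrite b00; field; rewrite gt_eqF.
  apply: (@sqr_incr_bound _ eta Fstar _ (F \o x) g) => //=; last by rewrite x00.
  move=> k; apply: descent_half_step (dec k) => //.
  by rewrite (le_trans Lb)// -b00 (le_of_sqr_incr _ _ _ b_gt0 g_ge0 bS).
- rewrite -b00; apply: (@sqr_incr_bound_small _ _ _ Fstar _ _ (F \o x) g) => //=.
  + by rewrite b00.
  + by rewrite x00.
  + by rewrite b00.
Qed.
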